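(* Let $A\le\mathcal{S}_m$, $B\le\mathcal{S}_n$ and $G=A\wr_P B$. (a) Let $b\in B$ have disjoint cycle decomposition $b=b_1\cdots b_\ell$ with exactly $\ell$ cycles (including trivial cycles). Then for every integer $k\ge0$ $$\delta_k(A^{[n]}b)=\sum_{j_1\cdots j_\ell=k}\ \prod_{r=1}^\ell\delta_{j_r}(A);$$ if $k=0$, then $\delta(A^{[n]}b)=1-(1-\delta(A))^\ell$. (b) For every integer $k\ge 0$ $$\delta_k(A\wr_P B)=\frac{1}{|B|}\sum_{\ell=1}^n\genfrac{[}{]}{0pt}{}{B}{\ell}\sum_{j_1\cdots j_\ell=k}\ \prod_{r=1}^\ell\delta_{j_r}(A);$$ if $k=0$, then $\delta(A\wr_P B)=1-\frac{1}{|B|}\sum_{\ell=1}^n\genfrac{[}{]}{0pt}{}{B}{\ell}(1-\delta(A))^\ell$. Here the sums over $j_1\cdots j_\ell=k$ run over all tuples $(j_1,\dots,j_\ell)\in\{0,\dots,m\}^\ell$ with product $k$.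
   Context: $\mathcal{S}_n$ is the symmetric group on $[n]=\{1,\dots,n\}$; permutations act on the right, $x\mapsto xg$. For a nonempty finite set $C$ of elements of a group acting on a finite set, $\delta_k(C)$ is the proportion of elements of $C$ with exactly $k$ fixed points, and $\delta(C)=\delta_0(C)$. $\delta_j(A)$ refers to the natural action on $[m]$. For $B\le\mathcal{S}_n$, $\genfrac{[}{]}{0pt}{}{B}{\ell}$ is the number of elements of $B$ with exactly $\ell$ cycles in their disjoint cycle decomposition (fixed points counted as cycles). The wreath product $A\wr B=A^{[n]}\rtimes B$ has underlying set $A^{[n]}\times B$ ($A^{[n]}$ being the group of functions $[n]\to A$ under pointwise multiplication) and multiplication $(\alpha,b)(\beta,c)=(\alpha\beta^{b^{-1}},bc)$, where $\beta^{b}(y)=\beta(yb^{-1})$. $A\wr_P B$ denotes $A\wr B$ acting on the set $[m]^{[n]}$ of functions $\omega\colon[n]\to[m]$ by $(\omega(\alpha,b))(y)=\omega(yb^{-1})\alpha(yb^{-1})$ (power action). $A^{[n]}b$ denotes the coset $\{(\alpha,b)\mid\alpha\in A^{[n]}\}$ in $A\wr_P B$, acting on $[m]^{[n]}$. *)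

(* Defs.v *)
From HB Require Import structures.
From mathcomp Require Import all_boot all_order all_algebra all_fingroup.

Set Implicit Arguments.
Unset Strict Implicit.
Unset Printing Implicit Defensive.

Import GroupScope GRing.Theory.

(* The symmetric group on [n] is 'S_n, acting on 'I_n = {0, ..., n-1}; in
   MathComp (g * h) x = h (g x), so permutations act on the right and the
   image x g is written g x. *)

Section Wreath.

Variables (gT : finGroupType) (n : nat).

(* gT wr 'S_n; for A <= gT and B <= 'S_n, the wreath product A wr B is the
   subgroup [wreath A B] below, with underlying set A^[n] x B. *)
Definition wreath_type : Type := ({ffun 'I_n -> gT} * 'S_n)%type.

HB.instance Definition _ := Finite.on wreath_type.

Implicit Types (u v w : wreath_type) (f : {ffun 'I_n -> gT}) (b : 'S_n).

(* f^b, given by f^b (y) = f (y b^-1) *)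
Definition twist f b : {ffun 'I_n -> gT} := [ffun y => f (b^-1 y)].

Definition wreath_mul u v : wreath_type :=
  ([ffun y => u.1 y * twist v.1 u.2^-1 y], u.2 * v.2).
Definition wreath_one : wreath_type := ([ffun=> 1], 1).
Definition wreath_inv u : wreath_type :=
  (twist [ffun y => (u.1 y)^-1] u.2, u.2^-1).

Fact wreath_mulA : associative wreath_mul.
Proof.
case=> f b [g c] [h d]; congr pair; last by rewrite /= mulgA.
by apply/ffunP=> y; rewrite !ffunE /= !invgK permM mulgA.
Qed.

Fact wreath_mul1 : left_id wreath_one wreath_mul.
Proof.
case=> f b; congr pair; last by rewrite /= mul1g.
by apply/ffunP=> y; rewrite !ffunE /= !invg1 perm1 mul1g.
Qed.

Fact wreath_mulV : left_inverse wreath_one wreath_inv wreath_mul.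
Proof.
case=> f b; congr pair; last by rewrite /= mulVg.
by apply/ffunP=> y; rewrite !ffunE /= invgK mulVg.
Qed.

HB.instance Definition _ :=
  Finite_isGroup.Build wreath_type wreath_mulA wreath_mul1 wreath_mulV.

Definition wreath (A : {set gT}) (B : {set 'S_n}) : {set wreath_type} :=
  [set u : wreath_type | (u.1 \in ffun_on A) && (u.2 \in B)].

Fact wreath_group_set (A : {group gT}) (B : {group 'S_n}) :
  group_set (wreath A B).
Proof.
apply/group_setP; split.
  by rewrite inE /= group1 andbT; apply/ffun_onP=> y; rewrite ffunE group1.
move=> u v; rewrite !inE => /andP[/ffun_onP uA uB] /andP[/ffun_onP vA vB].
rewrite /= groupM // andbT.
by apply/ffun_onP=> y; rewrite !ffunE groupM.
Qed.

Canonical wreath_group (A : {group gT}) (B : {group 'S_n}) :=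
  Group (wreath_group_set A B).

(* A^[n] b = {(a, b) | a in A^[n]} *)
Definition base_coset (A : {set gT}) (b : 'S_n) : {set wreath_type} :=
  [set u : wreath_type | (u.1 \in ffun_on A) && (u.2 == b)].

End Wreath.

Section PowerAction.

Variables m n : nat.

Definition power_act (x : {ffun 'I_n -> 'I_m}) (u : wreath_type 'S_m n) :
    {ffun 'I_n -> 'I_m} :=
  [ffun y => u.1 (u.2^-1 y) (x (u.2^-1 y))].

Fact power_act1 : power_act^~ 1 =1 id.
Proof.
by move=> x; apply/ffunP=> y; rewrite !ffunE /= invg1 !perm1.
Qed.

Fact power_actM x : act_morph power_act x.
Proof.
move=> u v; apply/ffunP=> y.
by rewrite !ffunE /= invMg invgK !permM permKV.
Qed.

Canonical power_action := TotalAction power_act1 power_actM.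

End PowerAction.

Arguments power_action {m n}.

Section FixedPointProportion.

Variables (aT : finGroupType) (T : finType) (to : {action aT &-> T}).

(* delta_k(C) and delta(C) *)
Definition fix_prop (k : nat) (C : {set aT}) : rat :=
  (#|[set g in C | #|'Fix_to[g]| == k]|%:R / #|C|%:R)%R.

Definition derangement_prop (C : {set aT}) : rat := fix_prop 0 C.

End FixedPointProportion.

(* The number of elements of B with exactly l cycles: [porbits b] is the set
   of orbits of <[b]> on 'I_n, so fixed points count as cycles. *)
Definition cycle_count n (B : {set 'S_n}) (l : nat) : nat :=
  #|[set b in B | #|porbits b| == l]|.

(* The sum of prod_r delta_(j_r)(A) over all (j_1, ..., j_l) in {0, ..., m}^l
   with product k. *)
Definition fix_prop_sum m (A : {set 'S_m}) (l k : nat) : rat :=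
  (\sum_(j : l.-tuple 'I_m.+1 | (\prod_(r < l) tnth j r)%N == k)
     \prod_(r < l) fix_prop ('P : {action 'S_m &-> 'I_m}) (tnth j r) A)%R.

(* Main.v *)
Require Import Defs.
From HB Require Import structures.
From mathcomp Require Import all_boot all_order all_algebra all_fingroup.

Set Implicit Arguments.
Unset Strict Implicit.
Unset Printing Implicit Defensive.

Import GroupScope GRing.Theory.

(* A fixed point x of (f, b) satisfies x(yb) = x(y)f(y), so it is determined by
   its values at representatives of the cycles of b, and such a value may be any
   fixed point of the product of f along the cycle.  Hence the number of fixed
   points of (f, b) is the product over the cycles of the numbers of fixed points
   of the cycle products.  As f ranges over A^[n], the cycle products are
   independent and uniform in A, because multiplying f(e) by the rest of its
   cycle, for each representative e, permutes A^[n]. *)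

(** * Preliminaries: families of choices, and exponents modulo a cycle length *)

Lemma card_family_prod (aT rT : finType) (F : aT -> pred rT) :
  #|family F| = (\prod_(x : aT) #|F x|)%N.
Proof. by rewrite card_family foldrE big_map big_enum. Qed.

Lemma iter_porbit_mod (T : finType) (s : {perm T}) x t :
  (s ^+ (t %% #|porbit s x|)) x = (s ^+ t) x.
Proof.
rewrite {2}(divn_eq t #|porbit s x|) expgD permM; congr (fun_of_perm _ _).
elim: (t %/ _) => [|q IHq]; first by rewrite mul0n perm1.
by rewrite mulSn expgD permM (permX s x) iter_porbit.
Qed.

(** The iterates of [x] with exponents below the orbit size are pairwise distinct, so reduced
    exponents can be read off from the points. *)
Lemma eq_iter_porbit (T : finType) (s : {perm T}) x t u :
  (s ^+ t) x = (s ^+ u) x -> t = u %[mod #|porbit s x|].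
Proof.
rewrite -(iter_porbit_mod s x t) -(iter_porbit_mod s x u) !permX => eq_tu.
have d0: (0 < #|porbit s x|)%N by rewrite lt0n card_porbit_neq0.
apply/eqP; rewrite -(nth_uniq x _ _ (uniq_traject_porbit s x)) ?size_traject
  ?ltn_mod // !nth_traject ?ltn_mod //.
exact/eqP.
Qed.

(** * Independence and uniformity of the cycle products *)

Section CycleProduct.

Variables (T : finType) (gT : finGroupType) (b : {perm T}).
Implicit Types (f : {ffun T -> gT}) (y : T).

Definition path_prod f t y : gT := \prod_(s < t) f ((b ^+ s) y).
Definition cycle_prod f y : gT := path_prod f #|porbit b y| y.

Lemma path_prodS f t y :
  path_prod f t.+1 y = path_prod f t y * f ((b ^+ t) y).
Proof. by rewrite /path_prod big_ord_recr. Qed.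

Lemma path_prod_head f t y :
  path_prod f t.+1 y = f y * \prod_(s < t) f ((b ^+ s.+1) y).
Proof. by rewrite /path_prod big_ord_recl /= expg0 perm1. Qed.

Variables (l : nat) (e : 'I_l -> T).
Hypothesis e_inj : forall i j, e j \in porbit b (e i) -> i = j.

(* Replacing the value of [f] at each chosen representative by the product
   of [f] along its cycle is a bijection of A^T: the representative occurs
   exactly once in that product, as its first factor. *)
Definition load_cycles f : {ffun T -> gT} :=
  [ffun y => if y \in codom e then cycle_prod f y else f y].

Lemma load_cycles_inj : injective load_cycles.
Proof.
move=> f g /ffunP eq_fg.
have off y: y \notin codom e -> f y = g y.
  by move=> /negbTE ye; have:= eq_fg y; rewrite !ffunE ye.
apply/ffunP=> y; have [/codomP[i def_y]|] := boolP (y \in codom e); last exact: off.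
have:= eq_fg y; rewrite !ffunE def_y codom_f /cycle_prod.
case def_d: #|_| => [|d]; first by have:= card_porbit_neq0 b (e i); rewrite def_d.
rewrite !path_prod_head.
(* The rest of the cycle contains no representative, so [f] and [g] agree on it and this common
   right factor cancels. *)
suffices ->: \prod_(s < d) f ((b ^+ s.+1) (e i)) =
             \prod_(s < d) g ((b ^+ s.+1) (e i)) by move/mulIg.
apply: eq_bigr => s _; apply: off; apply/codomP=> -[j def_j].
(* A representative met on the way would be [e i] itself, reached after [s.+1] steps, fewer than the
   cycle length [d.+1]. *)
have eq_ij: i = j by apply: e_inj; rewrite -def_j mem_porbit.
have: (b ^+ s.+1) (e i) = (b ^+ 0) (e i) by rewrite def_j eq_ij expg0 perm1.
move/eq_iter_porbit; rewrite def_d mod0n modn_small //.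
by rewrite ltnS.
Qed.

(** Closure of [A] under products makes [load_cycles] an injective self-map of a finite set, hence
    onto. *)
Lemma load_cycles_ffun_on (A : {group gT}) :
  load_cycles @: [set f in ffun_on A] = [set f in ffun_on A].
Proof.
apply/eqP; rewrite eqEcard card_imset ?leqnn ?andbT; last exact: load_cycles_inj.
apply/subsetP=> _ /imsetP[f + ->]; rewrite !inE => /ffun_onP fA.
apply/ffun_onP=> y; rewrite ffunE; case: ifP => // _.
by apply: group_prod => s _; apply: fA.
Qed.

(** The cycle products of [f] are the values of [load_cycles f] at the representatives, so the count
    is transported along this permutation of A^T. [P_ext] bridges families that agree only
    pointwise. *)
Lemma card_cycle_prods (A : {group gT}) (P : pred ('I_l -> gT)) :
    (forall u v, u =1 v -> P u = P v) ->
  #|[set f in ffun_on A | P (fun i => cycle_prod f (e i))]| =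
  #|[set f : {ffun T -> gT} in ffun_on A | P (fun i => f (e i))]|.
Proof.
move=> P_ext; rewrite -[LHS](card_imset _ load_cycles_inj).
have P_load f: P (fun i => load_cycles f (e i)) = P (fun i => cycle_prod f (e i)).
  by apply: P_ext => i; rewrite ffunE codom_f.
apply: eq_card => g; rewrite [RHS]inE; apply/imsetP/andP => [[f + ->]|[gA Pg]].
  rewrite inE => /andP[fA Pf]; rewrite P_load; split=> //.
  have: load_cycles f \in [set f in ffun_on A].
    by rewrite -load_cycles_ffun_on imset_f // inE.
  by rewrite inE.
have: g \in [set f in ffun_on A] by rewrite inE.
rewrite -load_cycles_ffun_on => /imsetP[f]; rewrite inE => fA def_g.
by exists f => //; rewrite inE fA -P_load -def_g.
Qed.

End CycleProduct.

(** * Fixed points of a single element [(f, b)] *)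

Section FixedPoints.

Variables (m n l : nat) (b : 'S_n) (e : 'I_l -> 'I_n).
Hypothesis e_inj : forall i j, e j \in porbit b (e i) -> i = j.
Hypothesis e_cover : forall y, exists i, y \in porbit b (e i).

Lemma fix_power_actP (f : {ffun 'I_n -> 'S_m}) (x : {ffun 'I_n -> 'I_m}) :
  reflect (forall y, x (b y) = f y (x y))
          (x \in 'Fix_power_action[((f, b) : wreath_type _ _)]).
Proof.
apply: (iffP afix1P) => [/ffunP fix_x y | fix_x].
  by have:= fix_x (b y); rewrite ffunE /= permK.
by apply/ffunP=> y; rewrite ffunE /= -fix_x permKV.
Qed.

(* A fixed point propagates along each cycle from its value at the
   representative, which must be fixed by the cycle product. *)
Lemma fix_path_prod (f : {ffun 'I_n -> 'S_m}) (x : {ffun 'I_n -> 'I_m}) t y :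
    (forall y, x (b y) = f y (x y)) ->
  x ((b ^+ t) y) = path_prod b f t y (x y).
Proof.
move=> fix_x; elim: t => [|t IHt].
  by rewrite /path_prod big_ord0 expg0 !perm1.
by rewrite path_prodS expgSr !permM fix_x IHt.
Qed.

(** A full turn contributes the cycle product, which fixes [c], and then the factors repeat. Thus
    the value transported to a point of the cycle does not depend on the exponent used to reach
    it. *)
Lemma path_prod_mod (f : {ffun 'I_n -> 'S_m}) y c t :
    cycle_prod b f y c = c ->
  path_prod b f (t %% #|porbit b y|) y c = path_prod b f t y c.
Proof.
move=> fix_c; set d := #|porbit b y|.
have step u: path_prod b f (d + u) y c = path_prod b f u y c.
  rewrite /path_prod big_split_ord /= permM.
  congr (fun_of_perm _ _); last exact: fix_c.
  apply: eq_bigr => s _; congr (f _).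
  by rewrite -iter_porbit_mod -/d modnDl iter_porbit_mod.
rewrite {2}(divn_eq t d); elim: (t %/ d) => [|q IHq]; first by rewrite mul0n.
by rewrite mulSn -addnA step.
Qed.

Lemma card_fix_power_act (f : {ffun 'I_n -> 'S_m}) :
  #|'Fix_power_action[((f, b) : wreath_type _ _)]| =
  (\prod_(i < l) #|'Fix_'P[cycle_prod b f (e i)]|)%N.
Proof.
pose F i := [pred c | c \in 'Fix_'P[cycle_prod b f (e i)]].
rewrite -(card_family_prod F).
(* Restriction to the representatives is shown to map the fixed points onto [family F]; its
   injectivity on them comes last. *)
pose r (x : {ffun 'I_n -> 'I_m}) := [ffun i => x (e i)].
rewrite -[LHS](@card_in_imset _ _ r) => [|x x' /fix_power_actP fx /fix_power_actP fx' eqr].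
  apply: eq_card => c; apply/imsetP/familyP => [[x /fix_power_actP fx ->] i | Fc].
    rewrite ffunE; apply/afix1P; rewrite /= /aperm -fix_path_prod //.
    by rewrite permX iter_porbit.
  have fix_c i: cycle_prod b f (e i) (c i) = c i.
    by have:= Fc i; move/afix1P.
  (* Each point gets a cycle index and an exponent. The exponent is an arbitrary choice, so [xE]
     below must hold for every exponent leading to the same point. *)
  have /fin_all_exists[p def_p] (y : 'I_n): exists p : 'I_l * nat, y = (b ^+ p.2) (e p.1).
    by have [i /porbitP[t ->]] := e_cover y; exists (i, t).
  pose x := [ffun y => path_prod b f (p y).2 (e (p y).1) (c (p y).1)].
  have xE i t: x ((b ^+ t) (e i)) = path_prod b f t (e i) (c i).
    rewrite ffunE; set y := (b ^+ t) (e i).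
    have eq_i: (p y).1 = i.
      apply: e_inj; rewrite porbit_sym -eq_porbit_mem.
      by rewrite -(porbit_perm b (p y).2) -def_p porbit_perm.
    have:= def_p y; rewrite eq_i => /eq_iter_porbit eq_t.
    by rewrite -path_prod_mod // -eq_t path_prod_mod.
  exists x; last first.
    apply/ffunP=> i; rewrite ffunE.
    by have:= xE i 0%N; rewrite expg0 perm1 /path_prod big_ord0 perm1.
  apply/fix_power_actP=> y; rewrite (def_p y) -permM -expgSr !xE.
  by rewrite path_prodS permM.
apply/ffunP=> y; have [i /porbitP[t ->]] := e_cover y.
rewrite (fix_path_prod _ _ fx) (fix_path_prod _ _ fx'); congr (fun_of_perm _ _).
by have /ffunP/(_ i) := eqr; rewrite !ffunE.
Qed.

End FixedPoints.

(** * Proportions in a coset of the base group *)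

Lemma porbit_representatives (T : finType) (b : {perm T}) :
  exists e : 'I_#|porbits b| -> T,
    (forall i j, e j \in porbit b (e i) -> i = j) /\
    (forall y, exists i, y \in porbit b (e i)).
Proof.
have /fin_all_exists[e def_e] (i : 'I_#|porbits b|): exists y, enum_val i = porbit b y.
  by have /imsetP[y _ ->] := enum_valP i; exists y.
exists e; split=> [i j | y].
  by rewrite -eq_porbit_mem -!def_e => /eqP/enum_val_inj.
have Oy: porbit b y \in porbits b by apply: imset_f.
exists (enum_rank_in Oy (porbit b y)).
by rewrite -def_e enum_rankK_in // porbit_id.
Qed.

Local Open Scope ring_scope.

Lemma card_natr_neq0 (gT : finGroupType) (G : {group gT}) : #|G|%:R != 0 :> rat.
Proof. by rewrite Num.Theory.pnatr_eq0 -lt0n cardG_gt0. Qed.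

Lemma card_fix_lt (m : nat) (g : 'S_m) :
  (#|'Fix_'P[g]| < m.+1)%N.
Proof. by rewrite ltnS -[leqRHS]card_ord max_card. Qed.

(** Sort the functions by their tuple of fixed point numbers at the points [e i]. Each class is a
    product of subsets of [A], one per coordinate, so its proportion in A^[n] is a product of
    proportions. *)
Lemma fix_prop_sumE (m n l : nat) (A : {group 'S_m}) (e : 'I_l -> 'I_n) k :
    injective e ->
  #|[set f : {ffun 'I_n -> 'S_m} in ffun_on A |
      \prod_(i < l) #|('Fix_'P[f (e i)])%g| == k]%N|%:R
    / #|A|%:R ^+ n = fix_prop_sum A l k.
Proof.
move=> e_inj; pose phi (g : 'S_m) := #|('Fix_'P[g])%g|.
pose J (f : {ffun 'I_n -> 'S_m}) : l.-tuple 'I_m.+1 := [tuple inord (phi (f (e i))) | i < l].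
have JE f i: tnth (J f) i = phi (f (e i)) :> nat.
  by rewrite tnth_mktuple inordK // card_fix_lt.
rewrite -sum1_card (partition_big J (fun j => (\prod_(r < l) tnth j r)%N == k)) /=; last first.
  by move=> f; rewrite inE => /andP[_ /eqP <-]; apply/eqP; apply: eq_bigr => i _; rewrite JE.
rewrite natr_sum mulr_suml; apply: eq_bigr => j /eqP jk.
(* As [e] is injective, at most one [i] constrains the coordinate [y]; off the image of [e] the
   condition is vacuous. *)
pose F y := [pred g in A | [forall i, (e i == y) ==> (phi g == tnth j i)]].
have ->: (\sum_(f | (f \in [set f : {ffun 'I_n -> 'S_m} in ffun_on A |
      (\prod_(i < l) phi (f (e i)))%N == k]) && (J f == j)) 1)%N = #|family F|.
  rewrite -sum1_card; apply: eq_bigl => f; rewrite inE.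
  apply/idP/familyP => [/andP[/andP[/ffun_onP fA _] /eqP Jf] y | fF].
    rewrite inE fA; apply/forallP=> i; apply/implyP=> /eqP <-.
    by rewrite -Jf JE.
  have phij i: phi (f (e i)) = tnth j i.
    have /andP[_ /forallP/(_ i)] := fF (e i).
    by rewrite eqxx => /eqP.
  rewrite -andbA; apply/and3P; split.
  - by apply/ffun_onP=> y; have /andP[] := fF y.
  - by rewrite -jk; apply/eqP; apply: eq_bigr => i _; apply: phij.
  by apply/eqP/eq_from_tnth => i; apply: val_inj; rewrite /= JE phij.
have ->: #|A|%:R ^+ n = \prod_(y < n) #|A|%:R :> rat.
  by rewrite prodr_const card_ord.
rewrite card_family_prod natr_prod -prodf_div (bigID (mem (e @: 'I_l))) /=.
(* The unconstrained coordinates contribute the factor 1. *)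
rewrite [X in _ * X]big1 ?mulr1 => [|y e'y].
  rewrite big_imset /=; last by move=> i i' _ _; apply: e_inj.
  apply: eq_bigr => i _; congr (_%:R / _); apply: eq_card => g.
  rewrite !inE; congr (_ && _); apply/forallP/eqP => [/(_ i)|phig i'].
    by rewrite eqxx => /eqP.
  by apply/implyP=> /eqP/e_inj ->; apply/eqP.
suffices ->: #|F y| = #|A| by rewrite divff ?card_natr_neq0.
apply: eq_card => g; rewrite !inE; case: (g \in A) => //=.
apply/forallP=> i; apply/implyP=> /eqP def_y.
by rewrite -def_y imset_f in e'y.
Qed.

Lemma card_base_coset (gT : finGroupType) (n : nat) (A : {set gT}) (b : 'S_n)
    (P : pred (wreath_type gT n)) :
  #|[set u in base_coset A b | P u]| =
  #|[set f : {ffun 'I_n -> gT} in ffun_on A | P (f, b)]|.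
Proof.
have pair_inj: injective (fun f : {ffun 'I_n -> gT} => (f, b) : wreath_type gT n).
  by move=> f g [].
rewrite -[RHS](card_imset _ pair_inj); apply: eq_card => -[f c]; rewrite !inE /=.
apply/andP/imsetP => [[/andP[fA /eqP ->] Pf]|[g + [-> ->]]].
  by exists f; rewrite // !inE fA.
by rewrite !inE eqxx => /andP[-> ->].
Qed.

Lemma card_base_cosetT (gT : finGroupType) (n : nat) (A : {set gT}) (b : 'S_n) :
  #|base_coset A b| = (#|A| ^ n)%N.
Proof.
have <-: [set u in base_coset A b | predT u] = base_coset A b.
  by apply/setP=> u; rewrite !inE andbT.
rewrite card_base_coset -[X in (_ ^ X)%N]card_ord -card_ffun_on.
by apply: eq_card => f; rewrite !inE andbT.
Qed.

(** The number of fixed points depends on [f] only through its cycle products, and these may be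
    replaced by the values of [f] at the representatives. *)
Lemma fix_prop_base_coset (m n : nat) (A : {group 'S_m}) (b : 'S_n) k :
  fix_prop power_action k (base_coset A b) = fix_prop_sum A #|porbits b| k.
Proof.
have [e [e_inj e_cover]] := porbit_representatives b.
have inj_e: injective e by move=> i j eq_e; apply: e_inj; rewrite eq_e porbit_id.
rewrite -(fix_prop_sumE A k inj_e) /fix_prop card_base_cosetT natrX.
rewrite card_base_coset.
pose P (g : 'I_#|porbits b| -> 'S_m) := (\prod_i #|('Fix_'P[g i])%g|)%N == k.
have P_ext u v: u =1 v -> P u = P v.
  by move=> eq_uv; congr (_ == _); apply: eq_bigr => i _; rewrite eq_uv.
rewrite -(card_cycle_prods e_inj A P_ext).
congr (_%:R / _); apply: eq_card => f; rewrite !inE.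
by rewrite (card_fix_power_act e_inj e_cover).
Qed.

Lemma sum_fix_prop (m : nat) (A : {group 'S_m}) :
  \sum_(j < m.+1) fix_prop ('P%act : {action 'S_m &-> 'I_m}) j A = 1.
Proof.
rewrite -mulr_suml -natr_sum.
suffices <-: #|A| = (\sum_(j < m.+1)
    #|[set g in A | #|('Fix_'P[g])%g| == j]|)%N.
  by rewrite divff ?card_natr_neq0.
rewrite -sum1_card (partition_big (fun g => Ordinal (card_fix_lt g)) predT) //=.
by apply: eq_bigr => j _; rewrite -sum1_card; apply: eq_bigl => g; rewrite inE.
Qed.

(** Pass to the complement: over all tuples the sum is the [l]-th power of a total mass 1, and a
    product is nonzero exactly when every entry is, so the complementary sum also factors. *)
Lemma fix_prop_sum0 (m l : nat) (A : {group 'S_m}) :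
  fix_prop_sum A l 0 =
  1 - (1 - fix_prop ('P%act : {action 'S_m &-> 'I_m}) 0 A) ^+ l.
Proof.
pose p (j : 'I_m.+1) := fix_prop ('P%act : {action 'S_m &-> 'I_m}) j A.
have nonzero: \sum_(j | j != ord0) p j = 1 - p ord0.
  have:= sum_fix_prop A; rewrite (bigD1 ord0) //= => <-.
  by rewrite addrAC subrr add0r.
(* The distributive law for big operators ranges over finite functions, hence the passage from
   tuples. *)
have reind Q : \sum_(j : l.-tuple 'I_m.+1 | Q j) \prod_(r < l) p (tnth j r) =
    \sum_(f : {ffun 'I_l -> 'I_m.+1} | Q [tuple f i | i < l]) \prod_(r < l) p (f r).
  rewrite (reindex (fun f : {ffun 'I_l -> 'I_m.+1} => [tuple f i | i < l])) /=.
    by apply: eq_bigr => f _; apply: eq_bigr => r _; rewrite tnth_mktuple.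
  exists (fun j : l.-tuple _ => [ffun i => tnth j i]) => [f _|j _].
    by apply/ffunP=> i; rewrite ffunE tnth_mktuple.
  by apply: eq_from_tnth => i; rewrite tnth_mktuple ffunE.
have: \sum_(j : l.-tuple 'I_m.+1) \prod_(r < l) p (tnth j r) = 1.
  by rewrite reind -(bigA_distr_bigA (fun _ => p)) /= big1 // => i _; apply: sum_fix_prop.
rewrite (bigID (fun j : l.-tuple ('I_m.+1) => (\prod_(r < l) tnth j r)%N == 0%N)) /=.
rewrite (reind (fun j : l.-tuple ('I_m.+1) => (\prod_(r < l) tnth j r)%N != 0%N)).
suffices ->: \sum_(f : {ffun 'I_l -> 'I_m.+1} |
    (\prod_(r < l) tnth [tuple f i | i < l] r)%N != 0%N) \prod_(r < l) p (f r) =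
    (1 - p ord0) ^+ l by move/(canRL (addrK _)).
rewrite -nonzero -[X in _ ^+ X]card_ord -prodr_const bigA_distr_big /=.
apply: eq_bigl => f; rewrite -lt0n; apply/idP/ffun_onP => [j_gt0 i | f_neq0].
  rewrite unfold_in -val_eqE /= -lt0n; move: j_gt0.
  by rewrite (bigD1 i) //= muln_gt0 tnth_mktuple => /andP[].
by apply: prodn_gt0 => i; rewrite tnth_mktuple lt0n; apply: f_neq0.
Qed.

(** * Averaging over the elements of [B] *)

Lemma card_wreath (gT : finGroupType) (n : nat) (A : {set gT}) (B : {set 'S_n})
    (P : pred (wreath_type gT n)) :
  #|[set u in wreath A B | P u]| =
  (\sum_(b in B) #|[set u in base_coset A b | P u]|)%N.
Proof.
rewrite -sum1_card (partition_big (fun u : wreath_type gT n => u.2) (mem B)) /=.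
  apply: eq_bigr => b bB; rewrite -sum1_card; apply: eq_bigl => u; rewrite !inE.
  by case: eqP => [->|_]; rewrite ?bB /= ?andbT ?andbF.
by move=> u; rewrite !inE => /andP[/andP[]].
Qed.

(** The wreath product is the disjoint union of the cosets over [b] in [B], all of size [#|A| ^ n],
    so its proportion is the plain average of theirs. *)
Lemma fix_prop_wreath (m n : nat) (A : {group 'S_m}) (B : {group 'S_n}) k :
  fix_prop power_action k (wreath A B) =
    #|B|%:R^-1 * \sum_(b in B) fix_prop_sum A #|porbits b| k.
Proof.
have cardW: #|wreath A B| = (#|B| * #|A| ^ n)%N.
  have:= card_wreath A B predT.
  have -> : [set u in wreath A B | predT u] = wreath A B.
    by apply/setP=> u; rewrite !inE andbT.
  move=> ->; rewrite -sum_nat_const; apply: eq_bigr => b _.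
  by rewrite -(card_base_cosetT A b); apply: eq_card => u; rewrite !inE andbT.
rewrite /fix_prop card_wreath cardW natrM invfM mulrCA natr_sum mulr_suml.
congr (_ * _); apply: eq_bigr => b _.
by rewrite -fix_prop_base_coset /fix_prop card_base_cosetT.
Qed.

Lemma card_porbits_bounds (n : nat) (b : 'S_n) :
  (0 < n)%N -> (0 < #|porbits b| < n.+1)%N.
Proof.
move=> n_gt0; apply/andP; split.
  by apply/card_gt0P; exists (porbit b (Ordinal n_gt0)); apply: imset_f.
by rewrite ltnS -[leqRHS]card_ord leq_imset_card.
Qed.

Lemma sum_cycle_count (n : nat) (B : {set 'S_n}) (F : nat -> rat) :
    (0 < n)%N ->
  \sum_(b in B) F #|porbits b| = \sum_(1 <= l < n.+1) (cycle_count B l)%:R * F l.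
Proof.
move=> n_gt0; rewrite big_add1 /= big_mkord.
(* Classes are labelled by the number of cycles minus one, matching the shifted index; since [n] is
   positive there is at least one cycle, and the predecessor loses nothing. *)
have ub (b : 'S_n) : (#|porbits b|.-1 < n)%N.
  by have /andP[c_gt0] := card_porbits_bounds b n_gt0; rewrite -[in X in X -> _](prednK c_gt0).
rewrite (partition_big (fun b => Ordinal (ub b)) predT) //=; apply: eq_bigr => l _.
rewrite mulr_natl -sumr_const; symmetry.
apply: eq_big => [b | b]; rewrite inE -?val_eqE /=.
  by have /andP[/prednK <- _] := card_porbits_bounds b n_gt0.
by case/andP=> _ /eqP ->.
Qed.

Theorem theorem6p5 (m n : nat) (hn : (0 < n)%N)
    (A : {group 'S_m}) (B : {group 'S_n}) :
  (forall (b : 'S_n) (l : nat), b \in B -> #|porbits b| = l ->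
     (forall k : nat,
        fix_prop power_action k (base_coset A b) = fix_prop_sum A l k) /\
     derangement_prop power_action (base_coset A b) =
       1 - (1 - derangement_prop 'P A) ^+ l) /\
  ((forall k : nat,
      fix_prop power_action k (wreath A B) =
        #|B|%:R^-1 *
          \sum_(1 <= l < n.+1) (cycle_count B l)%:R * fix_prop_sum A l k) /\
   derangement_prop power_action (wreath A B) =
     1 - #|B|%:R^-1 *
       \sum_(1 <= l < n.+1)
         (cycle_count B l)%:R * (1 - derangement_prop 'P A) ^+ l).
Proof.
split=> [b l _ <-|].
  split=> [k|]; first exact: fix_prop_base_coset.
  by rewrite /derangement_prop fix_prop_base_coset fix_prop_sum0.
split=> [k|].
  by rewrite fix_prop_wreath (sum_cycle_count B (fun l => fix_prop_sum A l k)).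
rewrite -(sum_cycle_count B (fun l => (1 - derangement_prop 'P A) ^+ l)) //.
rewrite /derangement_prop fix_prop_wreath.
under eq_bigr do rewrite fix_prop_sum0.
(* The average over [B] of the constant 1 is 1. *)
by rewrite sumrB sumr_const mulrBr mulVf ?card_natr_neq0.
Qed.
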